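(* Let $\mathsf{Y}$ be a finite set, $s:\mathsf{Y}\to\mathbb{R}$, $\mathcal{S}=\sup_{x}|s(x)|$, $q_\theta(x)=\exp(\theta s(x))$, $Z(\theta)=\sum_xq_\theta(x)$, $f(x|\theta)=q_\theta(x)/Z(\theta)$ for $\theta\in\Theta=\mathbb{R}$. Fix observed $y\in\mathsf{Y}$ and the Gaussian prior $\theta\sim\mathcal{N}(0,\sigma_0^2)$, and let $\pi(\theta|y)\propto\pi(\theta)f(y|\theta)$. Let $\Sigma>0$ and let $P_\Sigma$ be the discretized Langevin kernel $\theta'=\theta+\frac\Sigma2\nabla\log\pi(\theta|y)+\eta$, $\eta\sim\mathcal{N}(0,\Sigma)$, where $\nabla\log\pi(\theta|y)=-\theta/\sigma_0^2+s(y)-\mathbb{E}_{x\sim f(\cdot|\theta)}[s(x)]$. For $N\ge1$ let $\hat P_{\Sigma,N}$ be the noisy kernel: draw $y'_1,\dots,y'_N$ i.i.d. from $f(\cdot|\theta)$ and set $\theta'=\theta+\frac\Sigma2\big(-\theta/\sigma_0^2+s(y)-\frac1N\sum_{i=1}^Ns(y'_i)\big)+\eta$, $\eta\sim\mathcal{N}(0,\Sigma)$. If $\Sigma<\sigma_0^2$, then the chain with kernel $P_\Sigma$ is geometrically ergodic with some limiting distribution $\pi_\Sigma$; moreover, for all $N$ large enough the chain with kernel $\hat P_{\Sigma,N}$ is geometrically ergodic with some limiting distribution $\pi_{\Sigma,N}$, and $\|\pi_\Sigma-\pi_{\Sigma,N}\|\to0$ as $N\to\infty$.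
   Context: $\|\mu-\nu\|=\sup_A|\mu(A)-\nu(A)|$ is the total variation distance. $f(\cdot|\theta)$ is a one-parameter Gibbs random field. A chain is geometrically ergodic if it has an invariant distribution to which the $n$-step laws converge in total variation at a geometric rate (possibly depending on the starting point). *)

(* Defs.v *)
From HB Require Import structures.
From mathcomp Require Import all_boot all_order all_algebra.
From mathcomp Require Import all_classical all_reals all_analysis.
Set Implicit Arguments. Unset Strict Implicit. Unset Printing Implicit Defensive.
Import Order.TTheory GRing.Theory Num.Theory.
Import numFieldNormedType.Exports.
Local Open Scope classical_set_scope.
Local Open Scope ring_scope.

Section Gibbs.
Variables (R : realType) (Y : finType) (s : Y -> R).

Definition gibbs_q (theta : R) (x : Y) : R := expR (theta * s x).
Definition gibbs_Z (theta : R) : R := \sum_(x : Y) gibbs_q theta x.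
Definition gibbs_f (x : Y) (theta : R) : R := gibbs_q theta x / gibbs_Z theta.
Definition gibbs_mean_s (theta : R) : R := \sum_(x : Y) s x * gibbs_f x theta.

(* gradient of log posterior, Gaussian prior N(0, sigma0sq) (variance sigma0sq) *)
Definition grad_log_post (sigma0sq : R) (y : Y) (theta : R) : R :=
  - theta / sigma0sq + s y - gibbs_mean_s theta.

Definition langevin_density (sigma0sq Sigma : R) (y : Y) (theta theta' : R) : R :=
  normal_pdf (theta + Sigma / 2 * grad_log_post sigma0sq y theta)
             (Num.sqrt Sigma) theta'.

(* Transition density of the noisy kernel hat P_{Sigma,N}: mixture over the
   i.i.d. draws y'_1..y'_N ~ f(.|theta) (finitely many outcomes). *)
Definition noisy_density (sigma0sq Sigma : R) (y : Y) (N : nat)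
    (theta theta' : R) : R :=
  \sum_(ys : {ffun 'I_N -> Y})
    (\prod_(i < N) gibbs_f (ys i) theta) *
    normal_pdf (theta + Sigma / 2 *
                 (- theta / sigma0sq + s y - (N%:R)^-1 * \sum_(i < N) s (ys i)))
               (Num.sqrt Sigma) theta'.

End Gibbs.

Section Chains.
Variable R : realType.
Local Open Scope ereal_scope.

Fixpoint kstep (p : R -> R -> R) (n : nat) (x : R) (A : set R) : \bar R :=
  match n with
  | O => (\1_A x)%:E
  | n'.+1 => \int[lebesgue_measure]_z ((p x z)%:E * kstep p n' z A)
  end.

Definition tv_dist (mu nu : set R -> \bar R) : \bar R :=
  ereal_sup [set `|mu A - nu A| | A in [set A : set R | measurable A]].

Definition invariant (p : R -> R -> R) (pi : probability R R) : Prop :=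
  forall A : set R, measurable A ->
    pi A = \int[pi]_x kstep p 1 x A.

Definition geom_ergodic (p : R -> R -> R) (pi : probability R R) : Prop :=
  invariant p pi /\
  exists rho : R, (0 <= rho < 1)%R /\
    exists C : R -> R, forall (x : R) (n : nat),
      tv_dist (kstep p n x) pi <= (C x * rho ^+ n)%:E.

End Chains.

(* Main.v *)
(* Both chains are Gaussian mixtures whose component means have the form
   a theta + b with a = 1 - Sigma / (2 sigma0^2) in [0, 1) and |b| <= B, where a
   and B do not depend on N. Hence all the kernels satisfy the same drift
   inequality for |x| and the same minorization on a common ball. Dually to the
   contraction in weighted total variation of Hairer and Mattingly, the
   transition operator contracts, for a suitable beta, the seminorm
   inf_c sup_x |f x - c| / (1 + beta |x|); hence the iterates of an indicator
   function \1_A converge geometrically, uniformly in A and in N, to a constant,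
   which is the mass pi(A) under the invariant law. The one-step kernels differ
   by O(N^{-1/2}) in total variation, uniformly in theta, because the sampling
   error of the empirical mean has variance O(1/N); telescoping n steps with n
   large but fixed then compares the invariant laws. *)
Require Import Defs.
From HB Require Import structures.
From mathcomp Require Import all_boot all_order all_algebra.
From mathcomp Require Import all_classical all_reals all_analysis.
From mathcomp Require Import measurable_realfun ring lra.
Import Order.TTheory GRing.Theory Num.Theory.
Import numFieldNormedType.Exports.
Local Open Scope classical_set_scope.
Local Open Scope ring_scope.

Set Implicit Arguments.
Unset Strict Implicit.

(** * Markov densities acting on functions with values in [0, 1] *)

Section transition_operator.
Context {R : realType}.
Notation mu := (@lebesgue_measure R).
Implicit Types (w f g : R -> R) (p : R -> R -> R).

(** The total mass is left free, so that a minorant [h] and the residual [p x - h] of a transition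
    density are weights as well; the first moment makes functions of linear growth integrable. *)
Definition weight w :=
  [/\ measurable_fun setT w, (forall z, 0 <= w z),
      mu.-integrable setT (EFin \o w) &
      mu.-integrable setT (EFin \o (fun z => w z * `|z|))].

Lemma weight_integrable w f (c d : R) : weight w -> measurable_fun setT f ->
  (forall z, `|f z| <= c + d * `|z|) ->
  mu.-integrable setT (EFin \o (fun z => w z * f z)).
Proof.
move=> [mw w0 iw iwz] mf fb.
have i1 : mu.-integrable setT (EFin \o (fun z => c * w z + d * (w z * `|z|))).
  rewrite (_ : _ \o _ =
    (fun z => c%:E * (EFin \o w) z) \+
    (fun z => d%:E * (EFin \o (fun z => (w z * `|z|)%R)) z))%E.
    by apply: integrableD => //; apply: integrableZl.
  by apply/funext => z /=; rewrite EFinD !EFinM.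
apply: le_integrable i1 => //.
  by apply/measurable_EFinP; apply: measurable_funM.
move=> z _ /=; rewrite lee_fin normrM (ger0_norm (w0 z)).
apply: le_trans (ler_norm _).
rewrite (_ : _ + _ = w z * (c + d * `|z|)); last by ring.
by rewrite ler_wpM2l.
Qed.

Lemma weight_le w f (c d : R) : weight w -> measurable_fun setT f ->
  (forall z, `|f z| <= c + d * `|z|) ->
  `|\int[mu]_z (w z * f z)| <=
    c * \int[mu]_z (w z) + d * \int[mu]_z (w z * `|z|).
Proof.
move=> ww mf fb; have ifw := weight_integrable ww mf fb.
have [mw w0 iw iwz] := ww.
rewrite -RintegralZl// -RintegralZl//.
have Z (k : R) (g : R -> R) : mu.-integrable setT (EFin \o g) ->
    mu.-integrable setT (EFin \o (fun z => k * g z)).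
  by move=> ig; under [EFin \o _]eq_fun do rewrite /= EFinM; exact: integrableZl.
rewrite -RintegralD//; [|exact: Z..].
apply: le_trans (le_normr_Rintegral _ _) _ => //.
apply: le_Rintegral => //.
- have := integrable_norm ifw.
  by apply: eq_integrable => // z _ /=.
- rewrite (_ : _ \o _ = (EFin \o (fun z => c * w z)%R) \+
    (EFin \o (fun z => d * (w z * `|z|))%R))%E//.
  by apply: integrableD => //; exact: Z.
- move=> z _; rewrite normrM (ger0_norm (w0 z)).
  rewrite (_ : _ + _ = w z * (c + d * `|z|)); last by ring.
  by rewrite ler_wpM2l.
Qed.

Definition markov_density p :=
  [/\ (forall x, weight (p x)),
      measurable_fun setT (fun u : R * R => p u.1 u.2) &
      (forall x, \int[mu]_z (p x z) = 1)].

Definition transition p f (x : R) : R := \int[mu]_z (p x z * f z).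

(** The class of test functions: it contains the indicators, is stable under [transition], and keeps
    every integral finite. *)
Definition unit_valued f := measurable_fun setT f /\ forall z, 0 <= f z <= 1.

Lemma unit_valued_norm f : unit_valued f -> forall z, `|f z| <= 1 + 0 * `|z|.
Proof.
by move=> [_ f01] z; have /andP[f0 f1] := f01 z; rewrite mul0r addr0 ger0_norm.
Qed.

Lemma unit_valued_indic (A : set R) : measurable A -> unit_valued \1_A.
Proof.
move=> mA; split=> [|z]; first exact: measurable_indic.
by rewrite indicE; case: (_ \in _); rewrite lexx ler01.
Qed.

Lemma unit_valued_cst (c : R) : 0 <= c <= 1 -> unit_valued (cst c).
Proof. by move=> c01; split => //; exact: measurable_cst. Qed.

Lemma unit_valued_integrable p f x : markov_density p -> unit_valued f ->
  mu.-integrable setT (EFin \o (fun z => p x z * f z)).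
Proof.
move=> [wp _ _] uf; apply: (@weight_integrable _ _ 1 0) => //.
  by case: uf.
exact: unit_valued_norm.
Qed.

Lemma transition_lin p f g c d x : markov_density p -> unit_valued f ->
  unit_valued g -> transition p (fun z => c * f z + d * g z) x =
    c * transition p f x + d * transition p g x.
Proof.
move=> mp uf ug; rewrite /transition -!RintegralZl//; [|exact: unit_valued_integrable..].
have Z (k : R) h : unit_valued h ->
    mu.-integrable setT (EFin \o (fun z => k * (p x z * h z))).
  move=> uh; under [EFin \o _]eq_fun do rewrite /= EFinM.
  by apply: integrableZl => //; exact: unit_valued_integrable.
rewrite -RintegralD//; [|exact: Z..].
by apply: eq_Rintegral => z _; ring.
Qed.

Lemma transition_cst p c : markov_density p -> transition p (cst c) = cst c.
Proof.
move=> [wp _ p1]; apply/funext => x; rewrite /transition/= RintegralZr//.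
  by rewrite p1 mul1r.
by case: (wp x).
Qed.

Lemma transition_le p f g : markov_density p -> unit_valued f ->
  unit_valued g -> (forall z, f z <= g z) ->
  forall x, transition p f x <= transition p g x.
Proof.
move=> mp uf ug fg x; apply: le_Rintegral => //.
- exact: unit_valued_integrable.
- exact: unit_valued_integrable.
- by move=> z _; apply: ler_wpM2l => //; case: mp => /(_ x)[].
Qed.

Lemma transitionE p f x : markov_density p -> unit_valued f ->
  (transition p f x)%:E = (\int[mu]_z (p x z * f z)%:E)%E.
Proof.
move=> mp uf; rewrite /transition /Rintegral fineK//.
by apply: integrable_fin_num => //; exact: unit_valued_integrable.
Qed.

Lemma transition_unit_valued p f : markov_density p -> unit_valued f ->
  unit_valued (transition p f).
Proof.
move=> mp uf; split; last first.
  have le01 : 0 <= (1 : R) by exact: ler01.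
  have u0 : unit_valued (cst (0 : R)) by apply: unit_valued_cst; rewrite lexx.
  have u1 : unit_valued (cst (1 : R)) by apply: unit_valued_cst; rewrite lexx andbT.
  move=> x; apply/andP; split.
    have := @transition_le p (cst 0) f mp u0 uf _ x.
    by rewrite transition_cst//; apply => z; case: uf => _ /(_ z)/andP[].
  have := @transition_le p f (cst 1) mp uf u1 _ x.
  by rewrite transition_cst//; apply => z; case: uf => _ /(_ z)/andP[].
(* Measurability in the starting point comes from Tonelli, hence the joint measurability asked in
   [markov_density]. *)
apply/measurable_EFinP.
rewrite (_ : _ \o _ = fubini_F mu (fun u : R * R => (p u.1 u.2 * f u.2)%:E)); last first.
  by apply/funext => x /=; rewrite transitionE.
have [wp mpp _] := mp; have [mf f01] := uf.
apply: measurable_fun_fubini_tonelli_F.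
  apply/measurable_EFinP; apply: measurable_funM => //.
  exact: (measurableT_comp mf).
move=> u; rewrite lee_fin mulr_ge0//; first by case: (wp u.1).
by case/andP: (f01 u.2).
Qed.

Lemma iter_transition_unit_valued p f n : markov_density p -> unit_valued f ->
  unit_valued (iter n (transition p) f).
Proof.
by move=> mp uf; elim: n => //= n; exact: transition_unit_valued.
Qed.

Lemma iter_transition_lin p f g c d n x : markov_density p ->
  unit_valued f -> unit_valued g ->
  iter n (transition p) (fun z => c * f z + d * g z) x =
    c * iter n (transition p) f x + d * iter n (transition p) g x.
Proof.
move=> mp uf ug; elim: n x => //= n ih x.
rewrite -transition_lin//; [|exact: iter_transition_unit_valued..].
by congr transition; apply/funext.
Qed.

(** Replaces the extended-real integrals of [kstep] by iterates of a real-valued operator, which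
    stay in [0, 1]. *)
Lemma kstepE p n x A : markov_density p -> measurable A ->
  kstep p n x A = (iter n (transition p) \1_A x)%:E.
Proof.
move=> mp mA; elim: n x => //= n ih x; rewrite transitionE//.
  by apply: eq_integral => z _; rewrite ih EFinM.
by apply: iter_transition_unit_valued => //; exact: unit_valued_indic.
Qed.

(* Dominated convergence along the chain: this is what makes the limit law
   countably additive. *)
Lemma iter_transition_cvg0 p (f : nat -> R -> R) n x : markov_density p ->
  (forall k, unit_valued (f k)) -> (forall z, f ^~ z @ \oo --> 0) ->
  (fun k => iter n (transition p) (f k) x) @ \oo --> 0.
Proof.
move=> mp uf f0; elim: n x => [|n ih] x /=; first exact: f0.
pose g k := iter n (transition p) (f k).
have ug k : unit_valued (g k) by exact: iter_transition_unit_valued.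
have wp : weight (p x) by case: mp => /(_ x).
have [mw w0 iw _] := wp.
apply: (@fine_cvg _ _ _ _ (fun k => \int[mu]_z (p x z * g k z)%:E)%E).
rewrite (_ : 0%:E = (\int[mu]_z (cst 0 z))%E); last by rewrite integral0.
have := @dominated_convergence _ _ R mu setT measurableT
  (fun k z => (p x z * g k z)%:E) (cst 0%E) (EFin \o p x).
case=> //.
- move=> k; apply/measurable_EFinP; apply: measurable_funM => //.
  by case: (ug k).
- apply/aeW => z _ /=; apply: cvg_EFin; first exact: nearW.
  rewrite -[X in _ --> X](mulr0 (p x z)).
  by apply: cvgM; [exact: cvg_cst|exact: ih].
- apply/aeW => z k _ /=; rewrite lee_fin normrM (ger0_norm (w0 z)).
  rewrite -[leRHS]mulr1 ler_wpM2l//.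
  by rewrite (le_trans (unit_valued_norm (ug k) z))// mul0r addr0.
Qed.

End transition_operator.

(** * Harris convergence from drift and minorization *)

Section harris.
Context {R : realType}.
Notation mu := (@lebesgue_measure R).
Implicit Types (h f : R -> R) (p : R -> R -> R).

Lemma eq_norm_geometric0 (d C rho : R) : 0 <= rho < 1 ->
  (forall n, `|d| <= C * rho ^+ n) -> d = 0.
Proof.
move=> /andP[rho0 rho1] dC; apply/normr0_eq0/eqP.
rewrite eq_le normr_ge0 andbT.
have Crho : (fun n => C * rho ^+ n) @ \oo --> 0.
  rewrite -[X in _ --> X](mulr0 C); apply: cvgM; first exact: cvg_cst.
  by apply: cvg_expr; rewrite ger0_norm.
by apply: (cvgr_to_ge Crho); exact: nearW.
Qed.

(** With [D = w / (1 - rho)], the intervals of centre [u n] and radius [D * rho ^+ n] are nested,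
    because [D * (1 - rho) = w] absorbs each increment. The supremum of their left ends lies in all
    of them. *)
Lemma geometric_increments_cvg (u : nat -> R) (w rho : R) : 0 <= rho < 1 ->
  (forall n, `|u n.+1 - u n| <= w * rho ^+ n) ->
  exists l, forall n, `|u n - l| <= w / (1 - rho) * rho ^+ n.
Proof.
move=> /andP[rho0 rho1] uw.
pose D := w / (1 - rho).
have D1 : D * (1 - rho) = w by rewrite /D mulfVK// subr_eq0 eq_sym lt_eqF.
have lo m n : (m <= n)%N -> u m - D * rho ^+ m <= u n - D * rho ^+ n.
  elim: n => [|n ih]; first by rewrite leqn0 => /eqP ->.
  rewrite leq_eqVlt => /predU1P[->//|]; rewrite ltnS => /ih /le_trans; apply.
  have := uw n; rewrite ler_norml => /andP[h1 _].
  rewrite -D1 in h1; rewrite exprS.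
  rewrite -subr_ge0; apply: le_trans (_ : u n.+1 - u n + D * (1 - rho) * rho ^+ n <= _).
    by rewrite -lerBlDr sub0r.
  by rewrite le_eqVlt; apply/orP; left; apply/eqP; ring.
have hi m n : (m <= n)%N -> u n + D * rho ^+ n <= u m + D * rho ^+ m.
  elim: n => [|n ih]; first by rewrite leqn0 => /eqP ->.
  rewrite leq_eqVlt => /predU1P[->//|]; rewrite ltnS => /ih; apply: le_trans.
  have := uw n; rewrite ler_norml => /andP[_ h1].
  rewrite -D1 in h1; rewrite exprS -subr_ge0.
  apply: le_trans (_ : D * (1 - rho) * rho ^+ n - (u n.+1 - u n) <= _).
    by rewrite subr_ge0.
  by rewrite le_eqVlt; apply/orP; left; apply/eqP; ring.
have w0 : 0 <= D.
  rewrite divr_ge0 ?subr_ge0 ?(ltW rho1)//.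
  by have := uw 0%N; rewrite expr0 mulr1; exact: le_trans.
have lohi m n : u m - D * rho ^+ m <= u n + D * rho ^+ n.
  have h0 k : 0 <= D * rho ^+ k by rewrite mulr_ge0// exprn_ge0.
  have [mn|/ltnW nm] := leqP m n.
    by apply: le_trans (lo _ _ mn) _; rewrite lerD2l; have := h0 n; lra.
  by apply: le_trans (hi _ _ nm); rewrite lerD2l; have := h0 m; lra.
pose S := [set u n - D * rho ^+ n | n in [set: nat]].
have S0 : S !=set0 by exists (u 0%N - D * rho ^+ 0), 0%N.
exists (sup S) => n; rewrite ler_norml; apply/andP; split.
  rewrite -/D lerBrDl lerBlDr; apply: ge_sup => // _ [m _ <-]; exact: lohi.
rewrite -/D lerBlDl -lerBlDr; apply: ub_le_sup; last by exists n.
by exists (u 0%N + D * rho ^+ 0) => _ [m _ <-]; exact: lohi.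
Qed.

(** The intervals of centre [u x] and radius [b x] meet pairwise, so the supremum of their left ends
    lies in all of them. This turns an oscillation bound into closeness to one constant. *)
Lemma midpoint_of_pairwise_bound (T : Type) (x0 : T) (u b : T -> R) :
  (forall x y, `|u x - u y| <= b x + b y) -> exists c, forall x, `|u x - c| <= b x.
Proof.
move=> ub; pose S := [set u x - b x | x in [set: T]].
have S0 : S !=set0 by exists (u x0 - b x0), x0.
have lohi x y : u x - b x <= u y + b y.
  by have := ub x y; rewrite ler_norml => /andP[_]; lra.
exists (sup S) => x; rewrite ler_norml; apply/andP; split.
  rewrite lerBrDl lerBlDr; apply: ge_sup => // _ [y _ <-]; exact: lohi.
rewrite lerBlDl -lerBlDr; apply: ub_le_sup; last by exists x.
by exists (u x0 + b x0) => _ [y _ <-]; exact: lohi.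
Qed.

(** The constants and the minorant are parameters, so that one choice can serve the exact kernel and
    all noisy kernels at once. *)
Definition drift_minorized (a K r : R) h p :=
  [/\ markov_density p,
      (forall x, \int[mu]_z (p x z * `|z|) <= a * `|x| + K) &
      (forall x z, `|x| <= r -> h z <= p x z)].

(** * Contraction in the weighted seminorm *)

Section contraction.
Variables (a K : R) (h : R -> R).
Hypotheses (a01 : 0 <= a < 1) (K0 : 0 < K) (wh : weight h).
Let al := \int[mu]_z (h z).
Hypothesis al0 : 0 < al.
(** These choices give [(1 - a) * r = 4 * K] and [2 * (beta * K) = al]. The bound [delta <= 1 - a]
    keeps the coefficient of [|x| + |y|] nonnegative; what then remains is at least
    [al - delta * (2 + beta * r)] far from the origin and [al - 2 * delta] near it, both nonnegative
    by the second bound on [delta]. *)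
Let r := 4 * K / (1 - a).
Let beta := al / (2 * K).
Let delta := Num.min (1 - a) (al / (2 + beta * r)).
Let rho := 1 - delta.

Let beta_gt0 : 0 < beta. Proof. by rewrite divr_gt0// mulr_gt0. Qed.
Let r_gt0 : 0 < r.
Proof. by case/andP: a01 => a0 a1; rewrite divr_gt0 ?mulr_gt0 ?subr_gt0. Qed.

Let rho01 : 0 <= rho < 1.
Proof.
have := mulr_gt0 beta_gt0 r_gt0 => br; case/andP: a01 => a0 a1.
rewrite /rho subr_ge0 gtrBl ge_min lt_min subr_gt0 a1 divr_gt0 ?addr_gt0//.
by rewrite gerBl a0.
Qed.

Lemma transition_centered p f c x : drift_minorized a K r h p ->
  unit_valued f -> transition p f x - c = \int[mu]_z (p x z * (f z - c)).
Proof.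
move=> [mp _ _] uf; have [wp _ p1] := mp.
rewrite -[in LHS](mulr1 c) -(p1 x) -RintegralZl//; last by case: (wp x).
rewrite -RintegralB//; last 2 first.
  exact: unit_valued_integrable.
  rewrite (_ : _ \o _ = fun z => c%:E * (EFin \o p x) z)%E//.
  by apply: integrableZl => //; case: (wp x).
by apply: eq_Rintegral => z _; ring.
Qed.

Lemma transition_growth p f c t x : drift_minorized a K r h p ->
  unit_valued f -> 0 <= t -> (forall z, `|f z - c| <= t * (1 + beta * `|z|)) ->
  `|transition p f x - c| <= t * (1 + beta * (a * `|x| + K)).
Proof.
move=> dp uf t0 fc; rewrite (transition_centered _ _ dp)//.
have [[wp _ p1] pz _] := dp.
apply: (@le_trans _ _ (t * \int[mu]_z p x z +
  t * beta * \int[mu]_z (p x z * `|z|))).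
  apply: weight_le => //; first by apply: measurable_funB => //; case: uf.
  by move=> z; apply: le_trans (fc z) _; rewrite mulrDr mulr1 mulrA.
by rewrite p1 (mulrDr t) !mulr1 (mulrA t beta) lerD2l ler_wpM2l// mulr_ge0// ltW.
Qed.

(** The residual [p x - h] is a weight of mass [1 - al] whose first moment still obeys the drift
    bound. The integral against [h] does not depend on [x], so it cancels when two points are
    compared. *)
Lemma minorized_growth p f c t x : drift_minorized a K r h p ->
  unit_valued f -> 0 <= t -> (forall z, `|f z - c| <= t * (1 + beta * `|z|)) ->
  `|x| <= r ->
  `|transition p f x - c - \int[mu]_z (h z * (f z - c))| <=
    t * (1 - al + beta * (a * `|x| + K)).
Proof.
move=> dp uf t0 fc xr; rewrite (transition_centered _ _ dp)//.
have [[wp _ p1] pz ph] := dp.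
have [mp0 p0 ip ipz] := wp x; have [mh h0 ih ihz] := wh.
have fc' z : `|f z - c| <= t + t * beta * `|z|.
  by apply: le_trans (fc z) _; rewrite mulrDr mulr1 mulrA.
have mfc : measurable_fun setT (fun z => f z - c).
  by apply: measurable_funB => //; case: uf.
have wph : weight (fun z => p x z - h z).
  split.
  - exact: measurable_funB.
  - by move=> z; rewrite subr_ge0 ph.
  - rewrite (_ : _ \o _ = (EFin \o p x) \- (EFin \o h))%E//.
    exact: integrableB.
  - rewrite (_ : _ \o _ = (EFin \o (fun z => p x z * `|z|)%R) \-
      (EFin \o (fun z => h z * `|z|)%R))%E; first exact: integrableB.
    by apply/funext => z /=; rewrite -EFinB mulrBl.
rewrite -RintegralB//; [|exact: (weight_integrable _ mfc fc')..].
under eq_Rintegral do rewrite -mulrBl.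
apply: le_trans (weight_le wph mfc fc') _.
rewrite RintegralB// p1 -/al [leRHS]mulrDr -(mulrA t beta) lerD2l !ler_wpM2l//; first exact: ltW.
apply: le_trans (pz x); apply: le_Rintegral => //; first by case: wph.
by move=> z _; rewrite mulrBl gerBl mulr_ge0.
Qed.

(** Only differences between two points are estimated, which eliminates the centre [c];
    [midpoint_of_pairwise_bound] then supplies the new centre [c']. *)
Lemma transition_contraction p f c t : drift_minorized a K r h p ->
  unit_valued f -> 0 <= t -> (forall z, `|f z - c| <= t * (1 + beta * `|z|)) ->
  exists c', forall x,
    `|transition p f x - c'| <= rho * t * (1 + beta * `|x|).
Proof.
move=> dp uf t0 fc; apply: (midpoint_of_pairwise_bound 0) => x y.
case/andP: a01 => a0 a1.
have br0 := mulr_gt0 beta_gt0 r_gt0.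
have d1 : delta <= 1 - a by rewrite /delta ge_min lexx.
have d2 : delta * (2 + beta * r) <= al.
  by rewrite -ler_pdivlMr ?addr_gt0// /delta ge_min lexx orbT.
have bK : 2 * (beta * K) = al.
  by rewrite /beta; field; rewrite gt_eqF.
have rK : (1 - a) * r = 4 * K.
  by rewrite /r mulrC mulfVK// subr_eq0 eq_sym lt_eqF.
have d0 : 0 <= delta by have /andP[_] := rho01; rewrite /rho gtrBl; exact: ltW.
set s := `|x| + `|y|.
have s0 : 0 <= s by rewrite addr_ge0.
have rhs : rho * t * (1 + beta * `|x|) + rho * t * (1 + beta * `|y|) =
    t * (rho * (2 + beta * s)) by rewrite /s; ring.
rewrite rhs.
(* Far from the origin the drift inequality gains; near it, the minorization. *)
have [rs|sr] := leP r s.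
  apply: (@le_trans _ _ (t * (2 + beta * (a * s + 2 * K)))).
    have := transition_growth x dp uf t0 fc; have := transition_growth y dp uf t0 fc.
    rewrite (distrC _ c) => hy hx.
    rewrite -(subrKA c); apply: le_trans (ler_normD _ _) _.
    apply: le_trans (lerD hx hy) _.
    by rewrite le_eqVlt; apply/orP; left; apply/eqP; rewrite /s; ring.
  rewrite ler_wpM2l// /rho.
  have e1 : delta * (beta * r) <= (1 - a) * (beta * r) by rewrite ler_wpM2r// ltW.
  have e2 : (1 - a - delta) * beta * (s - r) >= 0.
    by rewrite mulr_ge0 ?subr_ge0// mulr_ge0 ?subr_ge0// ltW.
  have e3 : (1 - a) * r * beta = 2 * al by rewrite rK -bK; ring.
  nra.
have xr : `|x| <= r.
  by rewrite (le_trans _ (ltW sr))// /s lerDl.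
have yr : `|y| <= r.
  by rewrite (le_trans _ (ltW sr))// /s lerDr.
apply: (@le_trans _ _ (t * (2 - 2 * al + beta * (a * s + 2 * K)))).
  have := minorized_growth dp uf t0 fc xr; have := minorized_growth dp uf t0 fc yr.
  set J := \int[_]_z _ => hy hx.
  rewrite (_ : _ - _ = transition p f x - c - J - (transition p f y - c - J)); last by ring.
  apply: le_trans (ler_normB _ _) _; apply: le_trans (lerD hx hy) _.
  by rewrite le_eqVlt; apply/orP; left; apply/eqP; rewrite /s; ring.
rewrite ler_wpM2l// /rho.
have e1 : 0 <= (1 - a - delta) * beta * s.
  by rewrite mulr_ge0// mulr_ge0 ?subr_ge0// ltW.
have e2 := mulr_ge0 d0 (ltW br0).
nra.
Qed.

(** The order of the quantifiers is the point: the rate and [W] precede the kernel and the test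
    function, and the limit [l] precedes the starting point. *)
Lemma harris_convergence : exists rho0 W, 0 <= rho0 < 1 /\
  forall p, drift_minorized a K r h p -> forall f, unit_valued f ->
  exists l, forall x n, `|iter n (transition p) f x - l| <= W x * rho0 ^+ n.
Proof.
(* Sum of the bounds on [F n x - c n] and on [F n.+1 x - c n], with the factor [rho ^+ n] taken
   out. *)
pose w (x : R) : R := 2 + beta * `|x| + beta * (a * `|x| + K).
exists rho, (fun x => w x / (1 - rho)); split => // p dp f uf.
have /andP[rho0 rho1] := rho01.
have mp : markov_density p by case: dp.
pose F n := iter n (transition p) f.
have uF n : unit_valued (F n) by exact: iter_transition_unit_valued.
have /choice[c Fc] n : exists c, forall z,
    `|F n z - c| <= rho ^+ n * (1 + beta * `|z|).
  elim: n => [|n [c ih]]; last first.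
    by rewrite exprS; apply: (transition_contraction dp (uF n) _ ih); exact: exprn_ge0.
  exists 0 => z; rewrite subr0 expr0 mul1r.
  apply: le_trans (unit_valued_norm uf z) _.
  by rewrite mul0r addr0 lerDl mulr_ge0// ltW.
have step x n : `|F n.+1 x - F n x| <= w x * rho ^+ n.
  have h1 := transition_growth x dp (uF n) (exprn_ge0 n rho0) (Fc n).
  have := Fc n x; rewrite distrC => h2.
  rewrite -(subrKA (c n)); apply: le_trans (ler_normD _ _) _.
  apply: le_trans (lerD h1 h2) _.
  by rewrite le_eqVlt; apply/orP; left; apply/eqP; rewrite /w; ring.
have /choice[l Fl] x := geometric_increments_cvg rho01 (step x).
(* The limits from [0] and from [x] agree because at time [k] both orbits are within a multiple of
   [rho ^+ k] of the same centre [c k]. *)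
exists (l 0) => x n; suff -> : l 0 = l x by exact: Fl.
apply/subr0_eq/(@eq_norm_geometric0 _
  (w 0 / (1 - rho) + w x / (1 - rho) + (1 + beta * `|0|) + (1 + beta * `|x|)) rho) => // k.
rewrite (_ : _ - _ = - (F k 0 - l 0) + (F k x - l x) + (F k 0 - c k) - (F k x - c k)); last by ring.
apply: le_trans (ler_normB _ _) _; rewrite [leRHS]mulrDl [X in _ <= _ + X]mulrC lerD//.
apply: le_trans (ler_normD _ _) _; rewrite [leRHS]mulrDl [X in _ <= _ + X]mulrC lerD//.
apply: le_trans (ler_normD _ _) _; rewrite [leRHS]mulrDl lerD ?normrN//.
Qed.

End contraction.
End harris.

(** * Measures of mass one as probabilities *)

Section unit_mass.
Context {d : measure_display} {T : measurableType d} {R : realType}.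
Variables (nu : {measure set T -> \bar R}) (nuT : nu setT = 1%E).

(** An alias of [nu] that carries the proof of unit mass, on which the probability structure can be
    declared. *)
Definition unit_mass of nu setT = 1%E : set T -> \bar R := nu.

HB.instance Definition _ := isMeasure.Build _ _ _ (unit_mass nuT)
  (measure0 nu) (measure_ge0 nu) (@measure_semi_sigma_additive _ _ _ nu).

HB.instance Definition _ := Measure_isProbability.Build _ _ _ (unit_mass nuT) nuT.

End unit_mass.

(** * Construction of the invariant law from the limits of the iterates *)

Section limit_law.
Context {R : realType}.
Variables (p : R -> R -> R) (rho : R) (W : R -> R) (L : (R -> R) -> R).
Hypotheses (mp : markov_density p) (rho01 : 0 <= rho < 1).
Hypothesis iterL : forall f, unit_valued f ->
  forall x n, `|iter n (transition p) f x - L f| <= W x * rho ^+ n.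

Let iter_cvg f x : unit_valued f ->
  (fun n => iter n (transition p) f x) @ \oo --> L f.
Proof.
move=> uf; apply/cvgrPdist_le => e e0.
have /cvgrPdist_le/(_ _ e0) : (fun n => W x * rho ^+ n) @ \oo --> 0.
  rewrite -[X in _ --> X](mulr0 (W x)); apply: cvgM; first exact: cvg_cst.
  by have /andP[rho0 rho1] := rho01; apply: cvg_expr; rewrite ger0_norm.
apply: filterS => n; rewrite sub0r normrN => h.
by rewrite distrC (le_trans (iterL uf x n))// (le_trans _ h)// ler_norm.
Qed.

Let limit_lin f g c d : unit_valued f -> unit_valued g ->
  unit_valued (fun z => c * f z + d * g z) ->
  L (fun z => c * f z + d * g z) = c * L f + d * L g.
Proof.
move=> uf ug ufg; have := iter_cvg 0 ufg.
under eq_fun do rewrite iter_transition_lin//.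
move/cvg_unique; apply => //.
by apply: cvgD; (apply: cvgM; [exact: cvg_cst|exact: iter_cvg]).
Qed.

Let limit_ge0 f : unit_valued f -> 0 <= L f.
Proof.
move=> uf; apply: (cvgr_to_ge (iter_cvg 0 uf)); apply: nearW => n.
by have [_ /(_ 0)/andP[]] := iter_transition_unit_valued n mp uf.
Qed.

Let limit_le1 f : unit_valued f -> L f <= 1.
Proof.
move=> uf; apply: (cvgr_to_le (iter_cvg 0 uf)); apply: nearW => n.
by have [_ /(_ 0)/andP[]] := iter_transition_unit_valued n mp uf.
Qed.

(** The orbit of [transition p f] is that of [f] shifted by one step; this becomes the invariance of
    the law. *)
Let limit_transition f : unit_valued f -> L (transition p f) = L f.
Proof.
move=> uf; have h1 := iter_cvg 0 (transition_unit_valued mp uf).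
have h2 : (fun n => iter n (transition p) (transition p f) 0) @ \oo --> L f.
  have := iter_cvg 0 uf; rewrite -cvg_shiftS.
  by apply: cvg_trans; apply: near_eq_cvg; apply: nearW => n /=; rewrite -iterSr.
exact: (cvg_unique _ h1 h2).
Qed.

Let limit1 : L (cst 1) = 1.
Proof.
have u1 : unit_valued (cst (1 : R)) by apply: unit_valued_cst; rewrite ler01 lexx.
have := iter_cvg 0 u1.
rewrite (_ : (fun n => _) = cst 1); last first.
  apply/funext => n; elim: n => //= n.
  suff -> : iter n (transition p) (cst 1) = cst 1 by rewrite transition_cst.
  by elim: n => //= n ->; rewrite transition_cst.
by move/cvg_unique; apply => //; exact: cvg_cst.
Qed.

(* The value off the measurable sets only matters for positivity. *)
Let law (A : set R) : \bar R := (if `[< measurable A >] then L \1_A else 0)%:E.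

Let lawE A : measurable A -> law A = (L \1_A)%:E.
Proof. by move=> mA; rewrite /law asboolT. Qed.

Let law0 : law set0 = 0%E.
Proof.
rewrite lawE// indic0; have u0 : unit_valued (cst (0 : R)).
  by apply: unit_valued_cst; rewrite lexx ler01.
have := @limit_lin (cst 0) (cst 0) 0 0 u0 u0.
rewrite (_ : (fun z => _) = cst 0) => [/(_ u0)->|]; first by rewrite !mul0r addr0.
by apply/funext => z /=; rewrite mul0r addr0.
Qed.

Let law_ge0 A : (0 <= law A)%E.
Proof.
rewrite /law lee_fin; case: asboolP => // mA.
exact/limit_ge0/unit_valued_indic.
Qed.

(** By finite additivity the partial sums are [L \1_(T 0) - L \1_(T k)] with tails [T k], so the
    mass of the tails must vanish. One iterate [m] approximates [L] uniformly over all tails, and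
    for this fixed [m] dominated convergence applies, since the tails decrease to the empty set. *)
Let law_sigma_additive : semi_sigma_additive law.
Proof.
move=> F mF tF mU.
pose T k := \bigcup_(i in [set i | (k <= i)%N]) F i.
have mT k : measurable (T k) by exact: bigcup_measurable.
have uT k : unit_valued (\1_(T k) : R -> R) by exact: unit_valued_indic.
have uF k : unit_valued (\1_(F k) : R -> R) by exact: unit_valued_indic.
have Funiq i j z : F i z -> F j z -> i = j.
  by move=> Fi Fj; apply: tF => //; exists z.
have TE k : (\1_(T k) : R -> R) = fun z => 1 * \1_(F k) z + 1 * \1_(T k.+1) z.
  apply/funext => z; rewrite !mul1r !indicE.
  have [Fkz|nFkz] := pselect (F k z).
    rewrite (mem_set Fkz) mem_set; last by exists k => /=.
    rewrite memNset ?addr0// => -[i /= ki Fiz].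
    by move: ki; rewrite (Funiq _ _ _ Fiz Fkz) ltnn.
  rewrite (memNset nFkz) add0r; congr (nat_of_bool _)%:R; apply/idP/idP.
    move=> /set_mem[i /= ki Fiz]; apply: mem_set; exists i => //=.
    by rewrite ltn_neqAle ki andbT; apply/eqP => ik; apply: nFkz; rewrite ik.
  by move=> /set_mem[i /= ki Fiz]; apply: mem_set; exists i => //=; exact: ltnW.
have sumE k : L \1_(T 0%N) = \sum_(0 <= i < k) L \1_(F i) + L \1_(T k).
  elim: k => [|k ->]; first by rewrite big_geq// add0r.
  rewrite big_nat_recr//= -addrA; congr (_ + _).
  by rewrite {1}TE limit_lin// ?mul1r// -TE.
have UT : \bigcup_i F i = T 0%N by apply: eq_bigcupl; split.
rewrite UT lawE//.
rewrite (_ : (fun n => _) = EFin \o (fun n => L \1_(T 0%N) - L \1_(T n))); last first.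
  apply/funext => n /=; rewrite (sumE n) addrK -sumEFin.
  by apply: eq_bigr => i _; rewrite lawE.
apply: cvg_EFin; first exact: nearW.
rewrite -[X in _ --> X]subr0; apply: cvgB; first exact: cvg_cst.
apply/cvgrPdist_le => e e0; have e20 : 0 < e / 2 by rewrite divr_gt0.
have /cvgrPdist_le/(_ _ e20)[m _ /(_ m (leqnn m))] :
    (fun n => W 0 * rho ^+ n) @ \oo --> 0.
  rewrite -[X in _ --> X](mulr0 (W 0)); apply: cvgM; first exact: cvg_cst.
  by have /andP[rho0 rho1] := rho01; apply: cvg_expr; rewrite ger0_norm.
rewrite /= sub0r normrN => Wm.
have /cvgrPdist_le/(_ _ e20) :
    (fun k => iter m (transition p) \1_(T k) 0) @ \oo --> 0.
  apply: iter_transition_cvg0 => // z.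
  have [[i _ Fiz]|nUz] := pselect ((\bigcup_i F i) z).
    (* By disjointness a point of [F i] has left every tail [T k] with [k > i]. *)
    apply: cvg_near_cst; exists i.+1 => // k /= ik; apply/eqP.
    rewrite indicE memNset// => -[j /= kj Fjz].
    by move: ik; rewrite (Funiq _ _ _ Fiz Fjz) ltnNge kj.
  rewrite (_ : (fun k => _) = cst 0); first exact: cvg_cst.
  apply/funext => k; rewrite indicE memNset// => -[j /= kj Fjz].
  by apply: nUz; exists j.
apply: filterS => k; rewrite !sub0r !normrN => itk.
rewrite -normrN.
have := iterL (uT k) 0 m; rewrite distrC => h.
rewrite (_ : - L \1_(T k) = - (L \1_(T k) - iter m (transition p) \1_(T k) 0) -
  iter m (transition p) \1_(T k) 0); last by ring.
rewrite (splitr e) (le_trans (ler_normB _ _))// normrN lerD//.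
by rewrite (le_trans h)// (le_trans _ Wm)// ler_norm.
Qed.

Let law_setT : law setT = 1%E.
Proof. by rewrite lawE// indicT limit1. Qed.

(* Writing [f = 1/2 \1_A + 1/2 g] with [A = [1/2 <= f]] and [g] again
   unit-valued halves the error, so that it vanishes. *)
Lemma integral_of_unit_valued (pi : probability R R) f :
  (forall A, measurable A -> pi A = (L \1_A)%:E) -> unit_valued f ->
  (\int[pi]_x (f x)%:E)%E = (L f)%:E.
Proof.
move=> piE uf.
have int g : unit_valued g -> pi.-integrable setT (EFin \o g).
  move=> [mg g01]; apply: (@le_integrable _ _ _ pi _ _ _ (cst 1%E)) => //.
  - exact/measurable_EFinP.
  - move=> z _ /=; have /andP[g0 g1] := g01 z.
    by rewrite !ger0_norm// lee_fin.
  - exact: finite_measure_integrable_cst.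
pose I g := \int[pi]_x g x.
suff : I f - L f = 0.
  move/subr0_eq => <-; rewrite /I /Rintegral fineK//.
  by apply: integrable_fin_num => //; exact: int.
have half : 0 <= (2^-1 : R) < 1 by rewrite invr_ge0 ler0n invf_lt1 ?ltr1n.
apply: (@eq_norm_geometric0 _ _ 1 2^-1) => // n; rewrite mul1r.
elim: n f uf => [|n ih] f uf.
  rewrite expr0 ler_norml.
  have I0 : 0 <= I f by apply: Rintegral_ge0 => x _; case: uf => _ /(_ x)/andP[].
  have I1 : I f <= 1.
    apply: (@le_trans _ _ (\int[pi]_x cst 1 x)).
      apply: le_Rintegral => //; first exact: int.
        exact: finite_measure_integrable_cst.
      by move=> x _; case: uf => _ /(_ x)/andP[].
    by rewrite Rintegral_cst// mul1r; rewrite [X in fine X]probability_setT.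
  by have := limit_ge0 uf; have := limit_le1 uf; lra.
pose A := [set x | 2^-1 <= f x]; pose g x := 2 * f x - \1_A x.
have mA : measurable A.
  have [mf _] := uf; rewrite -[A]setTI.
  by have := mf measurableT `[2^-1, +oo[%classic (measurable_itv _);
    congr measurable; apply/seteqP; split => x /=; rewrite in_itv/= andbT.
have uA : unit_valued (\1_A : R -> R) by exact: unit_valued_indic.
have ug : unit_valued g.
  split.
    apply: measurable_funB; last exact: measurable_indic.
    by apply: measurable_funM => //; case: uf.
  move=> z; have [_ /(_ z)/andP[f0 f1]] := uf; rewrite /g indicE.
  have [Az|nAz] := pselect (A z).
    by rewrite (mem_set Az)/=; move: Az; rewrite /A/= => Az; lra.
  by rewrite (memNset nAz)/=; move: nAz => /negP; rewrite -ltNge => nAz; lra.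
have fE : f = fun z => 2^-1 * \1_A z + 2^-1 * g z.
  by apply/funext => z; rewrite /g; field.
have LfE : L f = 2^-1 * L \1_A + 2^-1 * L g.
  by rewrite {1}fE limit_lin// -fE.
have IfE : I f = 2^-1 * L \1_A + 2^-1 * I g.
  rewrite /I {1}fE RintegralD//; last 2 first.
  - under [EFin \o _]eq_fun do rewrite /= EFinM.
    by apply: integrableZl => //; exact: int.
  - under [EFin \o _]eq_fun do rewrite /= EFinM.
    by apply: integrableZl => //; exact: int.
  rewrite !RintegralZl//; [|exact: int..].
  congr (_ * _ + _).
  by rewrite /Rintegral integral_indic// setIT [X in fine X]piE.
rewrite IfE LfE exprS.
rewrite (_ : _ - _ = 2^-1 * (I g - L g)); last by ring.
by rewrite normrM gtr0_norm ?invr_gt0// ler_wpM2l ?invr_ge0// ih.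
Qed.

(** The one-step probability of [A] is unit-valued but no longer an indicator, so invariance needs
    [integral_of_unit_valued] to identify its integral as [L (transition p \1_A)]. *)
Lemma ex_limit_law : exists pi : probability R R, Defs.invariant p pi /\
  forall A, measurable A -> pi A = (L \1_A)%:E.
Proof.
have [nu nuE] : exists nu : {measure set R -> \bar R}, nu = law :> (_ -> _).
  by exists (HB.pack_for (measure R R) law
    (isMeasure.Build _ _ _ law law0 law_ge0 law_sigma_additive)).
have nuT : nu setT = 1%E by rewrite nuE law_setT.
pose pi : probability R R := unit_mass nuT.
have piE A : measurable A -> pi A = (L \1_A)%:E by rewrite /pi/= /unit_mass nuE; exact: lawE.
exists pi; split => // A mA; have uA := @unit_valued_indic R _ mA.
under eq_integral do rewrite kstepE//.
rewrite (integral_of_unit_valued piE); last exact: transition_unit_valued.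
by rewrite limit_transition// piE.
Qed.

End limit_law.

(** * Geometric ergodicity in total variation *)

Section ergodicity.
Context {R : realType}.

Lemma tv_dist_le (m1 m2 : set R -> \bar R) (c : R) :
  (forall A, measurable A -> exists r1 r2 : R,
     [/\ m1 A = r1%:E, m2 A = r2%:E & `|r1 - r2| <= c]) ->
  (tv_dist m1 m2 <= c%:E)%E.
Proof.
move=> mc; apply: ge_ereal_sup => _ [A mA <-].
by have [r1 [r2 [-> -> rc]]] := mc A mA; rewrite -EFinB lee_fin.
Qed.

(** Besides ergodicity, the conclusion keeps the given [rho] and [W], which [geom_ergodic] hides
    under existentials and which the comparison of invariant laws uses. *)
Lemma ex_geometric_limit (p : R -> R -> R) rho W : 0 <= rho < 1 ->
  markov_density p ->
  (forall f, unit_valued f -> exists l, forall x n,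
    `|iter n (transition p) f x - l| <= W x * rho ^+ n) ->
  exists pi : probability R R, geom_ergodic p pi /\
    forall A, measurable A -> exists2 l, pi A = l%:E &
      forall x n, `|iter n (transition p) \1_A x - l| <= W x * rho ^+ n.
Proof.
move=> rho01 mp cv.
(* [L] must be defined on all functions; it takes the default value 0 off the unit-valued ones. *)
have /choice[L HL] f : exists l, unit_valued f -> forall x n,
    `|iter n (transition p) f x - l| <= W x * rho ^+ n.
  by have [/cv[l lP]|nuf] := pselect (unit_valued f); [exists l|exists 0].
have [pi [pinv piE]] := ex_limit_law mp rho01 HL.
exists pi; split; last first.
  move=> A mA; exists (L \1_A); first exact: piE.
  exact/HL/unit_valued_indic.
split => //; exists rho; split => //; exists W => x n.
apply: tv_dist_le => A mA; exists (iter n (transition p) \1_A x), (L \1_A).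
by split; [exact: kstepE|exact: piE|exact/HL/unit_valued_indic].
Qed.

End ergodicity.

(** * Gaussian densities: moments, minorization and dependence on the mean *)

Section gaussian.
Context {R : realType}.
Notation mu := (@lebesgue_measure R).
Implicit Types m s z : R.

Lemma normal_pdf_expR m s z : s != 0 ->
  normal_pdf m s z = normal_peak s * expR (- (z - m) ^+ 2 / (s ^+ 2 *+ 2)).
Proof. by move=> s0; rewrite normal_pdfE. Qed.

Lemma normal_peakM (c s : R) : 0 < c -> normal_peak (c * s) = normal_peak s / c.
Proof.
move=> c0; rewrite /normal_peak exprMn -mulrA -mulrnAr sqrtrM ?sqr_ge0//.
by rewrite sqrtr_sqr gtr0_norm// invfM mulrC.
Qed.

(* With [u = (z - m) / s], this is [|u| <= 1 + 3 u^2 / 8 <= exp (3 u^2 / 8)]. *)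
Lemma norm_normal_pdf_le m s z : 0 < s ->
  `|z - m| * normal_pdf m s z <= 2 * s * normal_pdf m (2 * s) z.
Proof.
move=> s0; have s20 : 0 < 2 * s by rewrite mulr_gt0.
rewrite !normal_pdf_expR ?gt_eqF// normal_peakM//.
pose u := (z - m) / s.
have uE : z - m = u * s by rewrite /u divfK// gt_eqF.
have -> : - (z - m) ^+ 2 / (s ^+ 2 *+ 2) = - u ^+ 2 / 2.
  by rewrite uE; field; rewrite gt_eqF.
have -> : - (z - m) ^+ 2 / ((2 * s) ^+ 2 *+ 2) = - u ^+ 2 / 2 + 3 / 8 * u ^+ 2.
  by rewrite uE; field; rewrite gt_eqF.
rewrite uE normrM (gtr0_norm s0) expRD.
have e1 : `|u| <= expR (3 / 8 * u ^+ 2).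
  apply: le_trans (expR_ge1Dx _).
  rewrite -real_normK ?num_real//; have := sqr_ge0 (`|u| - 4 / 3); rewrite !expr2; lra.
have := @normal_peak_ge0 R s; set P := normal_peak s => P0.
have e0 := expR_ge0 (- u ^+ 2 / 2).
rewrite (_ : 2 * s * _ = s * P * expR (- u ^+ 2 / 2) * expR (3 / 8 * u ^+ 2)); last by field.
rewrite (_ : `|u| * s * _ = s * P * expR (- u ^+ 2 / 2) * `|u|); last by ring.
by rewrite ler_wpM2l// !mulr_ge0// ltW.
Qed.

(* [(z - m)^2 / 2 <= z^2 + m^2 <= 2 z^2 + M^2]: the worst mean only costs the
   factor [exp (- M^2 / s^2)]. *)
Lemma normal_pdf_minorization m s M z : 0 < s -> `|m| <= M ->
  expR (- M ^+ 2 / s ^+ 2) / 2 * normal_pdf 0 (2^-1 * s) z <= normal_pdf m s z.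
Proof.
move=> s0 mM; have s20 : 0 < 2^-1 * s by rewrite mulr_gt0// invr_gt0.
rewrite !normal_pdf_expR ?gt_eqF// normal_peakM ?invr_gt0// subr0.
rewrite (_ : _ * (_ * _) = normal_peak s *
  (expR (- M ^+ 2 / s ^+ 2) * expR (- z ^+ 2 / ((2^-1 * s) ^+ 2 *+ 2)))); last by field.
rewrite ler_wpM2l ?normal_peak_ge0// -expRD ler_expR.
have -> : - M ^+ 2 / s ^+ 2 + - z ^+ 2 / ((2^-1 * s) ^+ 2 *+ 2) =
  - ((2 * M ^+ 2 + 4 * z ^+ 2) / (s ^+ 2 *+ 2)) by field; rewrite gt_eqF.
rewrite mulNr lerN2 ler_wpM2r//; first by rewrite invr_ge0 mulrn_wge0// sqr_ge0.
have : m ^+ 2 <= M ^+ 2 by rewrite -[m ^+ 2]real_normK ?num_real// lerXn2r// nnegrE (le_trans _ mM).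
by have := sqr_ge0 (z + m); have := sqr_ge0 z; nra.
Qed.

(** For [x <= y] the difference is [expR (- x) * (1 - expR (- (y - x)))], at most
    [(y - x) * expR (- x)]. The sum on the right makes the bound symmetric. *)
Lemma expRN_dist_le (x y : R) :
  `|expR (- x) - expR (- y)| <= `|x - y| * (expR (- x) + expR (- y)).
Proof.
wlog xy : x y / x <= y => [hw|].
  have [/hw//|/ltW/hw] := leP x y.
  by rewrite distrC (distrC x) (addrC (expR (- y))).
have exy : expR (- y) <= expR (- x) by rewrite ler_expR lerN2.
rewrite ger0_norm ?subr_ge0// distrC ger0_norm ?subr_ge0//.
have e : expR (- y) = expR (- x) * expR (- (y - x)) by rewrite -expRD; congr expR; ring.
have := expR_ge1Dx (- (y - x)); have := expR_ge0 (- x); have := expR_ge0 (- y).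
have : 0 <= y - x by rewrite subr_ge0.
move: e; set E := expR (- x); set G := expR (- (y - x)); set E' := expR (- y) => ->.
by move=> d0 EG0 E0 G1; nra.
Qed.

(** The difference of the squares in the exponents factors as [(m2 - m1) * ((z - m1) + (z - m2))].
    Its second factor is recentred at the mean of whichever density multiplies it, so that only
    centred first moments have to be integrated. *)
Lemma normal_pdf_dist_le m1 m2 s z : 0 < s ->
  `|normal_pdf m1 s z - normal_pdf m2 s z| <=
  `|m1 - m2| / (s ^+ 2 *+ 2) *
    (normal_pdf m1 s z * (`|m1 - m2| + 2 * `|z - m1|) +
     normal_pdf m2 s z * (`|m1 - m2| + 2 * `|z - m2|)).
Proof.
move=> s0; have n0 : 0 < s ^+ 2 *+ 2 by rewrite mulrn_wgt0// exprn_gt0.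
rewrite !normal_pdf_expR ?gt_eqF// -mulrBr normrM ger0_norm ?normal_peak_ge0//.
have := @normal_peak_ge0 R s; set P := normal_peak s => P0.
rewrite !mulNr; have := expRN_dist_le ((z - m1) ^+ 2 / (s ^+ 2 *+ 2)) ((z - m2) ^+ 2 / (s ^+ 2 *+ 2)).
set e1 := expR (- ((z - m1) ^+ 2 / _)); set e2 := expR (- ((z - m2) ^+ 2 / _)).
have e10 : 0 <= e1 by exact: expR_ge0.
have e20 : 0 <= e2 by exact: expR_ge0.
rewrite -mulrBl (_ : _ ^+ 2 - _ ^+ 2 = (m2 - m1) * ((z - m1) + (z - m2))); last by ring.
rewrite !normrM (distrC m2) [`|_^-1|]gtr0_norm ?invr_gt0//.
set d := `|m1 - m2|; set t := `|z - m1 + (z - m2)| => h.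
have d0 : 0 <= d by exact: normr_ge0.
have t1 : t <= d + 2 * `|z - m1|.
  rewrite /t (_ : _ + _ = (m1 - m2) + (z - m1) *+ 2); last by ring.
  by rewrite (le_trans (ler_normD _ _))// normrMn mulr_natl.
have t2 : t <= d + 2 * `|z - m2|.
  rewrite /t /d distrC (_ : _ + _ = (m2 - m1) + (z - m2) *+ 2); last by ring.
  by rewrite (le_trans (ler_normD _ _))// normrMn mulr_natl.
apply: (@le_trans _ _ (P * (d * t / (s ^+ 2 *+ 2) * (e1 + e2)))); first exact: ler_wpM2l.
rewrite (_ : P * _ = d / (s ^+ 2 *+ 2) * (P * e1 * t + P * e2 * t)); last by ring.
rewrite ler_wpM2l//; first by rewrite divr_ge0// ltW.
by apply: lerD; rewrite ler_wpM2l// mulr_ge0.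
Qed.

(** By [norm_normal_pdf_le] the integrand is dominated by [2 * s] times a normal density of doubled
    deviation. *)
Lemma integral_normal_pdf_norm_le m s : 0 < s ->
  mu.-integrable setT (EFin \o (fun z => normal_pdf m s z * `|z - m|)) /\
  \int[mu]_z (normal_pdf m s z * `|z - m|) <= 2 * s.
Proof.
move=> s0.
have i2 : mu.-integrable setT (EFin \o (fun z => 2 * s * normal_pdf m (2 * s) z)).
  under [EFin \o _]eq_fun do rewrite /= EFinM.
  by apply: integrableZl => //; exact: integrable_normal_pdf.
have le2 z : normal_pdf m s z * `|z - m| <= 2 * s * normal_pdf m (2 * s) z.
  by rewrite mulrC; exact: norm_normal_pdf_le.
have i1 : mu.-integrable setT (EFin \o (fun z => normal_pdf m s z * `|z - m|)).
  apply: le_integrable i2 => //.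
    apply/measurable_EFinP; apply: measurable_funM; first exact: measurable_normal_pdf.
    by apply: measurableT_comp => //; apply: measurable_funB.
  move=> z _ /=; rewrite lee_fin [leLHS]ger0_norm ?mulr_ge0// ?normal_pdf_ge0//.
  by rewrite (le_trans (le2 z))// ler_norm.
split=> //; apply: le_trans (le_Rintegral _ i1 i2 (fun z _ => le2 z)) _ => //.
rewrite RintegralZl//; last exact: integrable_normal_pdf.
by rewrite /Rintegral integral_normal_pdf/= mulr1.
Qed.

Lemma Rintegral_normal_pdf m s : \int[mu]_z normal_pdf m s z = 1.
Proof. by rewrite /Rintegral integral_normal_pdf. Qed.

Lemma weight_normal_pdf m s : 0 < s -> weight (normal_pdf m s).
Proof.
move=> s0; have [i1 _] := integral_normal_pdf_norm_le m s0.
split; [exact: measurable_normal_pdf|exact: normal_pdf_ge0|exact: integrable_normal_pdf|].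
have i2 : mu.-integrable setT (EFin \o (fun z => `|m| * normal_pdf m s z)).
  under [EFin \o _]eq_fun do rewrite /= EFinM.
  by apply: integrableZl => //; exact: integrable_normal_pdf.
apply: le_integrable (integrableD measurableT i1 i2) => //.
  apply/measurable_EFinP; apply: measurable_funM; first exact: measurable_normal_pdf.
  exact: normr_measurable.
move=> z _ /=; rewrite lee_fin normrM normr_id (ger0_norm (normal_pdf_ge0 _ _ _)).
rewrite (le_trans _ (ler_norm _))// (mulrC `|m|) -mulrDr ler_wpM2l ?normal_pdf_ge0//.
by rewrite -{1}(subrK m z) ler_normD.
Qed.

Lemma normal_pdf_first_moment_le m s : 0 < s ->
  \int[mu]_z (normal_pdf m s z * `|z|) <= `|m| + 2 * s.
Proof.
move=> s0; have [i1 le1] := integral_normal_pdf_norm_le m s0.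
have [_ _ i0 iz] := weight_normal_pdf m s0.
have i2 : mu.-integrable setT (EFin \o (fun z => `|m| * normal_pdf m s z)).
  under [EFin \o _]eq_fun do rewrite /= EFinM.
  exact: integrableZl.
apply: (@le_trans _ _ (\int[mu]_z (`|m| * normal_pdf m s z + normal_pdf m s z * `|z - m|))).
  apply: le_Rintegral => //; first by have := integrableD measurableT i2 i1.
  move=> z _; rewrite (mulrC `|m|) -mulrDr ler_wpM2l ?normal_pdf_ge0//.
  by rewrite addrC -{1}(subrK m z) ler_normD.
by rewrite RintegralD// RintegralZl// Rintegral_normal_pdf mulr1 lerD2l.
Qed.

(** Integrates [normal_pdf_dist_le], each centred moment being at most [2 * s]. The bound is uniform
    in [f], hence a total variation estimate. *)
Lemma integral_normal_pdf_dist m1 m2 s f : 0 < s -> unit_valued f ->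
  `|\int[mu]_z (normal_pdf m1 s z * f z) - \int[mu]_z (normal_pdf m2 s z * f z)|
  <= (`|m1 - m2| ^+ 2 + 4 * s * `|m1 - m2|) / s ^+ 2.
Proof.
move=> s0 uf; have [mf f01] := uf.
have if_ m : mu.-integrable setT (EFin \o (fun z => normal_pdf m s z * f z)).
  apply: (weight_integrable (weight_normal_pdf m s0) mf).
  exact: unit_valued_norm.
rewrite -RintegralB//; set d := `|m1 - m2|.
have ig m : mu.-integrable setT (EFin \o (fun z => normal_pdf m s z * (d + 2 * `|z - m|))).
  apply: (@weight_integrable _ _ _ (d + 2 * `|m|) 2 (weight_normal_pdf m s0)).
    apply: measurable_funD => //; apply: measurable_funM => //.
    by apply: measurableT_comp => //; exact: measurable_funB.
  move=> z; rewrite ger0_norm ?addr_ge0 ?mulr_ge0 ?normr_ge0//.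
  by have := ler_normB z m; lra.
have Ig k : \int[mu]_z (normal_pdf k s z * (d + 2 * `|z - k|)) <= d + 4 * s.
  have [i1 le1] := integral_normal_pdf_norm_le k s0.
  rewrite (_ : \int[_]_z _ =
    \int[mu]_z (d * normal_pdf k s z + 2 * (normal_pdf k s z * `|z - k|))); last first.
    by apply: eq_Rintegral => x _; ring.
  rewrite RintegralD//; last 2 first.
    under [EFin \o _]eq_fun do rewrite /= EFinM.
    by apply: integrableZl => //; exact: integrable_normal_pdf.
    under [EFin \o _]eq_fun do rewrite /= EFinM.
    exact: integrableZl.
  rewrite !RintegralZl//; last exact: integrable_normal_pdf.
  by rewrite Rintegral_normal_pdf mulr1; lra.
apply: le_trans (le_normr_Rintegral _ _) _ => //.
  by have := integrableB measurableT (if_ m1) (if_ m2).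
pose c := d / (s ^+ 2 *+ 2).
have c0 : 0 <= c by rewrite divr_ge0 ?normr_ge0 ?mulrn_wge0 ?sqr_ge0.
have i3 := integrableD measurableT (ig m1) (ig m2).
apply: (@le_trans _ _ (\int[mu]_z (c * (normal_pdf m1 s z * (d + 2 * `|z - m1|) +
     normal_pdf m2 s z * (d + 2 * `|z - m2|))))).
  apply: le_Rintegral => //.
  - have := integrable_norm (integrableB measurableT (if_ m1) (if_ m2)).
    by apply: eq_integrable.
  - under [EFin \o _]eq_fun do rewrite /= EFinM.
    by apply: integrableZl => //; exact: i3.
  - move=> z _; rewrite -mulrBl normrM.
    apply: le_trans (normal_pdf_dist_le m1 m2 z s0).
    rewrite ler_piMr ?normr_ge0//.
    by have := unit_valued_norm uf z; rewrite mul0r addr0.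
rewrite RintegralZl// ?RintegralD//.
apply: (@le_trans _ _ (c * (d + 4 * s + (d + 4 * s)))); first by rewrite ler_wpM2l// lerD.
by rewrite le_eqVlt; apply/orP; left; apply/eqP; rewrite /c; field; rewrite gt_eqF.
Qed.

End gaussian.

(** * Finite nonnegative combinations of weights *)

Section weighted_sums.
Context {R : realType}.
Notation mu := (@lebesgue_measure R).
Implicit Types (f : R -> R).

Lemma weightZD (c : R) w1 w2 : 0 <= c -> weight w1 -> weight w2 ->
  weight (fun z => c * w1 z + w2 z).
Proof.
move=> c0 [m1 p1 i1 z1] [m2 p2 i2 z2]; split.
- by apply: measurable_funD => //; exact: measurable_funM.
- by move=> z; rewrite addr_ge0 ?mulr_ge0.
- rewrite (_ : _ \o _ = (fun z => c%:E * (EFin \o w1) z) \+ (EFin \o w2))%E.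
    by apply: integrableD => //; exact: integrableZl.
  by apply/funext => z /=; rewrite EFinD EFinM.
- rewrite (_ : _ \o _ = (fun z => c%:E * (EFin \o (fun z => (w1 z * `|z|)%R)) z) \+
    (EFin \o (fun z => (w2 z * `|z|)%R)))%E.
    by apply: integrableD => //; exact: integrableZl.
  by apply/funext => z /=; rewrite mulrDl EFinD -mulrA EFinM.
Qed.

Lemma weight0 : weight (fun _ : R => 0 : R).
Proof.
split => //; first exact: integrable0.
by under [EFin \o _]eq_fun do rewrite /= mul0r; exact: integrable0.
Qed.

Lemma weight_sum (J : Type) (r : seq J) (c : J -> R) (g : J -> R -> R) :
  (forall i, 0 <= c i) -> (forall i, weight (g i)) ->
  weight (fun z => \sum_(i <- r) c i * g i z).
Proof.
move=> c0 wg; elim: r => [|i r ih].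
  by under eq_fun do rewrite big_nil; exact: weight0.
by under eq_fun do rewrite big_cons; exact: weightZD.
Qed.

Lemma Rintegral_weight_sum (J : Type) (r : seq J) (c : J -> R) (g : J -> R -> R)
    f (k1 k2 : R) :
  (forall i, 0 <= c i) -> (forall i, weight (g i)) ->
  measurable_fun setT f -> (forall z, `|f z| <= k1 + k2 * `|z|) ->
  \int[mu]_z ((\sum_(i <- r) c i * g i z) * f z) =
    \sum_(i <- r) c i * \int[mu]_z (g i z * f z).
Proof.
move=> c0 wg mf fk; elim: r => [|i r ih].
  rewrite big_nil; under eq_Rintegral do rewrite big_nil mul0r.
  by rewrite Rintegral_cst// mul0r.
rewrite big_cons -ih -RintegralZl//; last exact: (weight_integrable (wg i) mf fk).
rewrite -RintegralD//.
- by apply: eq_Rintegral => z _; rewrite big_cons mulrDl mulrA.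
- under [EFin \o _]eq_fun do rewrite /= EFinM.
  apply: integrableZl => //; exact: (weight_integrable (wg i) mf fk).
- exact: (weight_integrable (weight_sum r c0 wg) mf fk).
Qed.

End weighted_sums.

(** * Drift and minorization for Gaussian mixtures *)

Section gaussian_mixture.
Context {R : realType}.
Notation mu := (@lebesgue_measure R).

(** All components share the slope [a], and [b] is meant to be bounded. The exact kernel is the case
    of one component; the noisy kernel has one component per sample. *)
Definition gaussian_mixture (I : finType) (w b : I -> R -> R) (a s x z : R) : R :=
  \sum_i w i x * normal_pdf (a * x + b i x) s z.

Variables (I : finType) (w b : I -> R -> R) (a s B : R).
Hypotheses (a0 : 0 <= a) (s0 : 0 < s).
Hypothesis w0 : forall i x, 0 <= w i x.
Hypothesis w1 : forall x, \sum_i w i x = 1.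
Hypothesis mw : forall i, measurable_fun setT (w i).
Hypothesis mb : forall i, measurable_fun setT (b i).
Hypothesis bB : forall i x, `|b i x| <= B.

Let p := gaussian_mixture w b a s.

Let weight_p x : weight (p x).
Proof. by apply: weight_sum => i //; exact: weight_normal_pdf. Qed.

Lemma transition_gaussian_mixture f x : unit_valued f ->
  transition p f x = \sum_i w i x * \int[mu]_z (normal_pdf (a * x + b i x) s z * f z).
Proof.
move=> [mf f01]; apply: (@Rintegral_weight_sum _ _ _ _ _ _ 1 0) => //.
  by move=> i; exact: weight_normal_pdf.
exact: unit_valued_norm.
Qed.

Lemma markov_gaussian_mixture : markov_density p.
Proof.
split => //.
- rewrite /p /gaussian_mixture; apply: measurable_sum => i.
  apply: measurable_funM; first exact: (measurableT_comp (mw i)).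
  under eq_fun do rewrite (normal_pdf_expR _ _ (lt0r_neq0 s0)).
  apply: measurable_funM => //; apply: measurableT_comp => //.
  apply: measurable_funM => //; apply: measurableT_comp => //.
  apply: measurable_funX => //; apply: measurable_funB => //.
  apply: measurable_funD; first exact: measurable_funM.
  exact: (measurableT_comp (mb i)).
- move=> x; have u1 : unit_valued (cst (1 : R)).
    by apply: unit_valued_cst; rewrite ler01 lexx.
  have := transition_gaussian_mixture x u1.
  rewrite /transition; under eq_Rintegral do rewrite mulr1.
  move=> ->; rewrite -[RHS](w1 x); apply: eq_bigr => i _.
  under eq_Rintegral do rewrite mulr1.
  by rewrite Rintegral_normal_pdf mulr1.
Qed.

Lemma drift_gaussian_mixture x :
  \int[mu]_z (p x z * `|z|) <= a * `|x| + (B + 2 * s).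
Proof.
have -> : \int[mu]_z (p x z * `|z|) =
    \sum_i w i x * \int[mu]_z (normal_pdf (a * x + b i x) s z * `|z|).
  apply: (@Rintegral_weight_sum _ _ _ _ _ _ 0 1) => //.
    by move=> i; exact: weight_normal_pdf.
  by move=> z; rewrite normr_id add0r mul1r.
rewrite -[leRHS]mul1r -[X in _ <= X * _](w1 x) mulr_suml; apply: ler_sum => i _.
rewrite ler_wpM2l// (le_trans (normal_pdf_first_moment_le _ s0))//.
rewrite [leRHS]addrA lerD2r (le_trans (ler_normD _ _))// normrM (ger0_norm a0).
by rewrite lerD2l.
Qed.

(** The lower bound of [normal_pdf_minorization] with [M = a * r + B], which bounds the means
    reached from the ball of radius [r]. It is free of the index set and of the mixing weights,
    hence common to all [N]. *)
Definition mixture_minorant (s a B r z : R) : R :=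
  expR (- (a * r + B) ^+ 2 / s ^+ 2) / 2 * normal_pdf 0 (2^-1 * s) z.

Lemma drift_minorized_gaussian_mixture r :
  drift_minorized a (B + 2 * s) r (mixture_minorant s a B r) p.
Proof.
split; [exact: markov_gaussian_mixture|exact: drift_gaussian_mixture|].
move=> x z xr; rewrite -[leLHS]mul1r -[X in X * _ <= _](w1 x) mulr_suml.
apply: ler_sum => i _; rewrite ler_wpM2l//.
apply: normal_pdf_minorization => //.
rewrite (le_trans (ler_normD _ _))// lerD// normrM (ger0_norm a0).
exact: ler_wpM2l.
Qed.

End gaussian_mixture.

(** * Positive mass of the minorant *)

Section mixture_minorant.
Context {R : realType}.
Variables (s a B r : R).
Hypothesis s0 : 0 < s.

Let c0 : 0 < expR (- (a * r + B) ^+ 2 / s ^+ 2) / 2.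
Proof. by rewrite divr_gt0// expR_gt0. Qed.

Lemma weight_mixture_minorant : weight (mixture_minorant s a B r).
Proof.
have s20 : 0 < 2^-1 * s by rewrite mulr_gt0// invr_gt0.
have := weightZD (ltW c0) (weight_normal_pdf 0 s20) weight0.
by under eq_fun do rewrite addr0.
Qed.

Lemma Rintegral_mixture_minorant_gt0 :
  0 < \int[lebesgue_measure]_z mixture_minorant s a B r z.
Proof.
rewrite RintegralZl//; last exact: integrable_normal_pdf.
by rewrite Rintegral_normal_pdf mulr1.
Qed.

End mixture_minorant.

(** * Second moment of a sum of independent centred draws *)

Section iid_sum.
Context {R : realType} {Y : finType}.
Variables (N : nat) (f : Y -> R).
Hypothesis f1 : \sum_y f y = 1.

Lemma sum_prod_weights : \sum_(ys : {ffun 'I_N -> Y}) \prod_(i < N) f (ys i) = 1.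
Proof.
rewrite -(bigA_distr_bigA (fun (_ : 'I_N) y => f y)) big1// => i _.
Qed.

(** Once both factors [g] are absorbed into their coordinates, the sum over samples is a product of
    one-coordinate sums; for distinct [j] and [k] the coordinate [j] contributes the zero mean. *)
Lemma sum_prod_weights_cross (g : Y -> R) (j k : 'I_N) : \sum_y f y * g y = 0 ->
  \sum_(ys : {ffun 'I_N -> Y}) (\prod_(i < N) f (ys i)) * (g (ys j) * g (ys k)) =
    (j == k)%:R * \sum_y f y * g y ^+ 2.
Proof.
move=> g0.
pose F (i : 'I_N) (y : Y) := f y * ((if i == j then g y else 1) * (if i == k then g y else 1)).
have FE (ys : {ffun 'I_N -> Y}) :
    (\prod_(i < N) f (ys i)) * (g (ys j) * g (ys k)) = \prod_(i < N) F i (ys i).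
  by rewrite /F !big_split/= -!big_mkcond/= !big_pred1_eq.
under eq_bigr do rewrite FE.
rewrite -(bigA_distr_bigA F) (bigD1 j)//= /F eqxx.
have [<-|jk] := eqVneq j k.
  rewrite mul1r [X in _ * X]big1 ?mulr1; first by under eq_bigr do rewrite -expr2.
  by move=> i ij; rewrite (negbTE ij) mulr1; under eq_bigr do rewrite mulr1.
by under eq_bigr do rewrite mulr1; rewrite g0 !mul0r.
Qed.

Lemma iid_sum_second_moment (g : Y -> R) : \sum_y f y * g y = 0 ->
  \sum_(ys : {ffun 'I_N -> Y})
    (\prod_(i < N) f (ys i)) * (\sum_(i < N) g (ys i)) ^+ 2 =
  N%:R * \sum_y f y * g y ^+ 2.
Proof.
move=> g0.
under eq_bigr do rewrite expr2 big_distrlr/= mulr_sumr.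
rewrite exchange_big/=.
under eq_bigr do (under eq_bigr do rewrite mulr_sumr; rewrite exchange_big/=).
under eq_bigr do under eq_bigr do rewrite sum_prod_weights_cross//.
rewrite (eq_bigr (fun _ => \sum_y f y * g y ^+ 2)) => [|j _].
  by rewrite sumr_const card_ord mulr_natl.
rewrite (bigD1 j)//= eqxx mul1r [X in _ + X]big1 ?addr0// => k kj.
by rewrite eq_sym (negbTE kj) mul0r.
Qed.

End iid_sum.

(** * Bounds on the Gibbs family and on the sampling error *)

Section gibbs_bounds.
Context {R : realType} {Y : finType}.
Variables (s : Y -> R) (y : Y).

Lemma gibbs_Z_gt0 theta : 0 < gibbs_Z s theta.
Proof.
rewrite /gibbs_Z (bigD1 y)//= ltr_pwDl ?expR_gt0// sumr_ge0// => x _.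
exact: expR_ge0.
Qed.

Lemma gibbs_f_ge0 x theta : 0 <= gibbs_f s x theta.
Proof. by rewrite divr_ge0 ?expR_ge0// ltW// gibbs_Z_gt0. Qed.

Lemma sum_gibbs_f theta : \sum_x gibbs_f s x theta = 1.
Proof. by rewrite -mulr_suml divff// gt_eqF// gibbs_Z_gt0. Qed.

Lemma measurable_gibbs_f x : measurable_fun setT (gibbs_f s x).
Proof.
have mq z : measurable_fun setT (fun theta => gibbs_q s theta z).
  by apply: measurableT_comp => //; exact: measurable_funM.
apply: measurable_funM => //.
(* Positivity of the partition function reduces the measurability of its inverse to that of [expR]
   and [ln]. *)
have -> : (fun theta => (gibbs_Z s theta)^-1) = (fun theta => expR (- ln (gibbs_Z s theta))).
  by apply/funext => theta; rewrite expRN lnK// posrE gibbs_Z_gt0.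
apply: measurableT_comp => //; apply: measurableT_comp => //.
apply: (measurableT_comp (@measurable_ln R)); exact: measurable_sum.
Qed.

Lemma measurable_gibbs_mean_s : measurable_fun setT (gibbs_mean_s s).
Proof.
apply: measurable_sum => x; apply: measurable_funM => //.
exact: measurable_gibbs_f.
Qed.

(** Stands in for the supremum of [|s|], which it dominates; any bound independent of [theta] and
    [N] would do. *)
Definition norm_sum : R := \sum_x `|s x|.

Lemma norm_le_norm_sum x : `|s x| <= norm_sum.
Proof. by rewrite /norm_sum (bigD1 x)//= lerDl sumr_ge0. Qed.

Lemma norm_sum_ge0 : 0 <= norm_sum.
Proof. by rewrite sumr_ge0. Qed.

Lemma gibbs_mean_s_le theta : `|gibbs_mean_s s theta| <= norm_sum.
Proof.
rewrite (le_trans (ler_norm_sum _ _ _))// -[leRHS]mulr1 -[X in _ <= _ * X](sum_gibbs_f theta).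
rewrite mulr_sumr ler_sum// => x _.
by rewrite normrM (ger0_norm (gibbs_f_ge0 _ _)) ler_wpM2r ?gibbs_f_ge0 ?norm_le_norm_sum.
Qed.

Lemma empirical_mean_le N (ys : {ffun 'I_N -> Y}) :
  `|N%:R^-1 * \sum_(i < N) s (ys i)| <= norm_sum.
Proof.
(* For [N = 0] the convention that zero has inverse zero makes the empirical mean vanish, so the
   bound covers every [N]. *)
have [NE|N0] := posnP N.
  by have -> : N%:R = 0 :> R; [rewrite NE|rewrite invr0 mul0r normr0 norm_sum_ge0].
rewrite normrM gtr0_norm ?invr_gt0 ?ltr0n// mulrC ler_pdivrMr ?ltr0n//.
rewrite (le_trans (ler_norm_sum _ _ _))//.
apply: (@le_trans _ _ (\sum_(i < N) norm_sum)).
  by rewrite ler_sum// => i _; exact: norm_le_norm_sum.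
by rewrite sumr_const card_ord mulr_natr.
Qed.

(** After centring, the second moment of the sum is [N] times the variance of one draw, itself at
    most [(2 * norm_sum s) ^+ 2]; dividing by the square of [N] leaves [1 / N]. *)
Lemma empirical_mean_variance N theta : (0 < N)%N ->
  \sum_(ys : {ffun 'I_N -> Y}) (\prod_(i < N) gibbs_f s (ys i) theta) *
    (N%:R^-1 * \sum_(i < N) s (ys i) - gibbs_mean_s s theta) ^+ 2 <=
  (2 * norm_sum) ^+ 2 / N%:R.
Proof.
move=> N0; pose g x := s x - gibbs_mean_s s theta.
have Nn0 : N%:R != 0 :> R by rewrite pnatr_eq0 -lt0n.
have g0 : \sum_x gibbs_f s x theta * g x = 0.
  under eq_bigr do rewrite mulrBr.
  rewrite sumrB -mulr_suml sum_gibbs_f mul1r; apply/eqP; rewrite subr_eq0; apply/eqP.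
  by apply: eq_bigr => x _; rewrite mulrC.
have E (ys : {ffun 'I_N -> Y}) :
    N%:R^-1 * (\sum_(i < N) s (ys i)) - gibbs_mean_s s theta =
    N%:R^-1 * \sum_(i < N) g (ys i).
  rewrite /g sumrB sumr_const card_ord mulrBr -[X in _ = _ - _ * X]mulr_natl.
  by rewrite mulKf.
under eq_bigr do rewrite E exprMn mulrCA.
rewrite -mulr_sumr (iid_sum_second_moment _ (sum_gibbs_f theta) g0).
rewrite exprVn expr2 invfM -mulrA (mulrA _ N%:R) mulVf// mul1r mulrC.
rewrite ler_wpM2r// -[leRHS]mul1r -[X in _ <= X * _](sum_gibbs_f theta) mulr_suml ler_sum// => x _.
rewrite ler_wpM2l ?gibbs_f_ge0// -real_normK ?num_real//.
rewrite lerXn2r ?nnegrE ?mulr_ge0 ?norm_sum_ge0// /g mulr_natl mulr2n.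
by rewrite (le_trans (ler_normB _ _))// lerD// ?norm_le_norm_sum// gibbs_mean_s_le.
Qed.

End gibbs_bounds.

(** * The two Langevin kernels as Gaussian mixtures *)

Section langevin_kernels.
Context {R : realType} {Y : finType}.
Variables (s : Y -> R) (y : Y) (v Sigma : R).
Hypotheses (v0 : 0 < v) (Sigma0 : 0 < Sigma).

Let a := 1 - Sigma / (2 * v).
Let B := Sigma * norm_sum s.
Let sd := Num.sqrt Sigma.

(** The part of the mean left after [a * theta]. The exact and noisy kernels differ only in [m],
    which is the Gibbs expectation or its empirical estimate. *)
Definition langevin_drift (m : R) : R := Sigma / 2 * (s y - m).

Lemma langevin_densityE : langevin_density s v Sigma y =
  gaussian_mixture (fun (_ : 'I_1) _ => 1)
    (fun _ theta => langevin_drift (gibbs_mean_s s theta)) a sd.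
Proof.
apply/funext => theta; apply/funext => z.
rewrite /langevin_density (_ : theta + _ =
  a * theta + langevin_drift (gibbs_mean_s s theta)); last first.
  by rewrite /grad_log_post /langevin_drift /a; field; rewrite gt_eqF.
by rewrite /gaussian_mixture big_ord1 mul1r.
Qed.

Lemma noisy_densityE N : noisy_density s v Sigma y N =
  gaussian_mixture
    (fun (ys : {ffun 'I_N -> Y}) theta => \prod_(i < N) gibbs_f s (ys i) theta)
    (fun ys _ => langevin_drift (N%:R^-1 * \sum_(i < N) s (ys i))) a sd.
Proof.
apply/funext => theta; apply/funext => z.
rewrite /noisy_density /gaussian_mixture; apply: eq_bigr => ys _.
rewrite (_ : theta + _ = a * theta +
  langevin_drift (N%:R^-1 * \sum_(i < N) s (ys i)))//.
move: (N%:R^-1 * _) => m.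
by rewrite /langevin_drift /a; field; rewrite gt_eqF.
Qed.

Lemma langevin_drift_le m : `|m| <= norm_sum s -> `|langevin_drift m| <= B.
Proof.
move=> mS; rewrite /langevin_drift normrM gtr0_norm ?divr_gt0//.
rewrite /B (_ : Sigma * norm_sum s = Sigma / 2 * (norm_sum s + norm_sum s)); last by field.
rewrite ler_wpM2l//; first by rewrite divr_ge0// ltW.
by rewrite (le_trans (ler_normB _ _))// lerD// norm_le_norm_sum.
Qed.

Hypothesis a0 : 0 <= a.

Let sd0 : 0 < sd. Proof. by rewrite sqrtr_gt0. Qed.

Lemma measurable_prod_gibbs_f N (ys : {ffun 'I_N -> Y}) :
  measurable_fun setT (fun theta => \prod_(i < N) gibbs_f s (ys i) theta).
Proof. by apply: measurable_prod => i _; exact: (measurable_gibbs_f _ y). Qed.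

Lemma drift_minorized_langevin r : drift_minorized a (B + 2 * sd) r
  (mixture_minorant sd a B r) (langevin_density s v Sigma y).
Proof.
rewrite langevin_densityE; apply: drift_minorized_gaussian_mixture => //.
- by move=> x; rewrite big_ord1.
- move=> _; apply: measurable_funM => //; apply: measurable_funB => //.
  exact: (measurable_gibbs_mean_s _ y).
- by move=> _ x; apply/langevin_drift_le/(gibbs_mean_s_le _ y).
Qed.

Lemma drift_minorized_noisy N r : drift_minorized a (B + 2 * sd) r
  (mixture_minorant sd a B r) (noisy_density s v Sigma y N).
Proof.
rewrite noisy_densityE; apply: drift_minorized_gaussian_mixture => //.
- by move=> ys x; apply: prodr_ge0 => i _; exact: (gibbs_f_ge0 _ y).
- by move=> x; exact: (sum_prod_weights N (sum_gibbs_f s y x)).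
- by move=> ys; exact: measurable_prod_gibbs_f.
- by move=> ys x; apply/langevin_drift_le/empirical_mean_le.
Qed.

(* AM-GM trades the first absolute moment of the sampling error for its variance. *)
Lemma transition_noisy_dist N e f theta : (0 < N)%N -> 0 < e -> unit_valued f ->
  `|transition (langevin_density s v Sigma y) f theta -
    transition (noisy_density s v Sigma y N) f theta| <=
  e + (1 + 4 / e) / Sigma * B ^+ 2 / N%:R.
Proof.
move=> N0 e0 uf.
rewrite langevin_densityE noisy_densityE !transition_gaussian_mixture//; last first.
  by move=> ys x; apply: prodr_ge0 => i _; exact: (gibbs_f_ge0 _ y).
rewrite big_ord1 mul1r.
pose J m := \int[lebesgue_measure]_z (normal_pdf (a * theta + langevin_drift m) sd z * f z).
pose w (ys : {ffun 'I_N -> Y}) := \prod_(i < N) gibbs_f s (ys i) theta.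
pose m0 := gibbs_mean_s s theta.
pose m1 (ys : {ffun 'I_N -> Y}) := N%:R^-1 * \sum_(i < N) s (ys i).
have w0 ys : 0 <= w ys by apply: prodr_ge0 => i _; exact: (gibbs_f_ge0 _ y).
have w1 : \sum_ys w ys = 1 by exact: (sum_prod_weights N (sum_gibbs_f s y theta)).
(* The exact transition is spread over the samples with the same weights, so that the comparison is
   made component by component. *)
rewrite [X in `|X - _|](_ : _ = \sum_ys w ys * J m0); last first.
  by rewrite -mulr_suml w1 mul1r.
rewrite -sumrB.
rewrite (le_trans (ler_norm_sum _ _ _))//.
have V := empirical_mean_variance s y theta N0.
apply: (@le_trans _ _ (\sum_ys (w ys * e +
    (1 + 4 / e) / Sigma * (Sigma / 2) ^+ 2 * (w ys * (m1 ys - m0) ^+ 2)))).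
  apply: ler_sum => ys _; rewrite -mulrBr normrM (ger0_norm (w0 ys)).
  rewrite (mulrCA _ (w ys)) -mulrDr ler_wpM2l//.
  apply: le_trans (integral_normal_pdf_dist _ _ sd0 uf) _.
  set d := `|_|.
  have d0 : 0 <= d by exact: normr_ge0.
  have d2 : d ^+ 2 = (Sigma / 2) ^+ 2 * (m1 ys - m0) ^+ 2.
    rewrite /d real_normK ?num_real// /langevin_drift /m1 /m0.
    by move: (N%:R^-1 * _) => m; ring.
  rewrite (_ : (1 + 4 / e) / Sigma * (Sigma / 2) ^+ 2 * (m1 ys - m0) ^+ 2 =
    (1 + 4 / e) / sd ^+ 2 * d ^+ 2); last first.
    by rewrite d2 [RHS]mulrA; congr (_ / _ * _ * _); rewrite sqr_sqrtr// ltW.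
  have -> : (d ^+ 2 + 4 * sd * d) / sd ^+ 2 = d ^+ 2 / sd ^+ 2 + 4 * (d / sd).
    by field; rewrite gt_eqF.
  set u := d / sd.
  have -> : (1 + 4 / e) / sd ^+ 2 * d ^+ 2 = u ^+ 2 + 4 * u ^+ 2 / e.
    by rewrite /u; field; rewrite !gt_eqF.
  have -> : d ^+ 2 / sd ^+ 2 = u ^+ 2 by rewrite /u; field; rewrite gt_eqF.
  (* Expanding this square gives [4 * u <= e + 4 * u ^+ 2 / e]. *)
  have : 0 <= (e - 2 * u) ^+ 2 / e by rewrite divr_ge0 ?sqr_ge0// ltW.
  rewrite (_ : (e - 2 * u) ^+ 2 / e = e - 4 * u + 4 * u ^+ 2 / e); last first.
    by field; rewrite gt_eqF.
  lra.
rewrite big_split/= -mulr_suml w1 mul1r lerD2l -mulr_sumr.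
rewrite (_ : _ / N%:R = (1 + 4 / e) / Sigma * (Sigma / 2) ^+ 2 *
  ((2 * norm_sum s) ^+ 2 / N%:R)); last first.
  by rewrite /B; field; rewrite !gt_eqF ?ltr0n.
by rewrite ler_wpM2l// !mulr_ge0 ?sqr_ge0 ?invr_ge0 ?addr_ge0 ?mulr_ge0 ?invr_ge0 ?ltW.
Qed.

End langevin_kernels.

(** * Perturbation of the iterates *)

Section perturbation.
Context {R : realType}.

Lemma transition_dist_le (p : R -> R -> R) f g (c : R) x : markov_density p ->
  unit_valued f -> unit_valued g -> (forall z, `|f z - g z| <= c) ->
  `|transition p f x - transition p g x| <= c.
Proof.
move=> mp uf ug fg; have [wp _ p1] := mp.
have <- : \int[lebesgue_measure]_z (p x z * (f z - g z)) =
    transition p f x - transition p g x.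
  rewrite /transition -RintegralB//; [|exact: unit_valued_integrable..].
  by apply: eq_Rintegral => z _; rewrite mulrBr.
have := @weight_le _ (p x) (fun z => f z - g z) c 0 (wp x).
rewrite p1 mulr1 mul0r addr0; apply.
  by apply: measurable_funB; [case: uf|case: ug].
by move=> z; rewrite mul0r addr0.
Qed.

(** Replacing the outermost kernel costs [e], and applying [p] does not amplify the distance already
    accumulated, by [transition_dist_le]. *)
Lemma iter_transition_dist_le (p q : R -> R -> R) (e : R) f n x :
  markov_density p -> markov_density q ->
  (forall g z, unit_valued g -> `|transition p g z - transition q g z| <= e) ->
  unit_valued f ->
  `|iter n (transition p) f x - iter n (transition q) f x| <= n%:R * e.
Proof.
move=> mp mq pq uf; elim: n x => [|n ih] x; first by rewrite subrr normr0 mul0r.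
have up := iter_transition_unit_valued n mp uf.
have uq := iter_transition_unit_valued n mq uf.
rewrite !iterS -(subrKA (transition p (iter n (transition q) f) x)).
rewrite (le_trans (ler_normD _ _))// -natr1 mulrDl mul1r.
by apply: lerD; [exact: (transition_dist_le x mp up uq ih)|exact: pq].
Qed.

Lemma tv_dist_ge0 (m1 m2 : probability R R) : (0 <= tv_dist m1 m2)%E.
Proof.
by apply: ereal_sup_ubound; exists set0; rewrite //= !measure0 subee// abse0.
Qed.

Lemma tv_dist_cvg0 (m : probability R R) (mN : nat -> probability R R) :
  (forall e : R, 0 < e -> \forall N \near \oo, (tv_dist m (mN N) <= e%:E)%E) ->
  (fun N => tv_dist m (mN N)) @ \oo --> 0%E.
Proof.
move=> tv; have fin (e : R) N : (tv_dist m (mN N) <= e%:E)%E ->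
    tv_dist m (mN N) \is a fin_num.
  by move=> le_e; rewrite ge0_fin_numE ?tv_dist_ge0// (le_lt_trans le_e)// ltry.
apply: cvg_EFin.
  by have := tv 1 ltr01; apply: filterS => N; exact: fin.
apply/cvgrPdist_le => e e0; have := tv e e0; apply: filterS => N le_e /=.
rewrite sub0r normrN ger0_norm ?fine_ge0 ?tv_dist_ge0//.
by rewrite -lee_fin fineK// (fin _ _ le_e).
Qed.

End perturbation.

(** * Ergodicity of both chains and comparison of their invariant laws *)

Unset Implicit Arguments.

Theorem theorem4 (R : realType) (Y : finType) (s : Y -> R) (y : Y)
    (sigma0 Sigma : R) :
  0 < sigma0 -> 0 < Sigma -> Sigma < sigma0 ^+ 2 ->
  exists piS : probability R R,
    geom_ergodic (langevin_density s (sigma0 ^+ 2) Sigma y) piS /\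
    exists N0 : nat, exists piSN : nat -> probability R R,
      (forall N : nat, (N0 <= N)%N ->
         geom_ergodic (noisy_density s (sigma0 ^+ 2) Sigma y N) (piSN N)) /\
      ((fun N => tv_dist piS (piSN N)) @ \oo --> 0%E).
Proof.
move=> sigma00 Sigma0 Sigma_lt.
set v := sigma0 ^+ 2; have v0 : 0 < v by exact: exprn_gt0.
pose a := 1 - Sigma / (2 * v); pose B := Sigma * norm_sum s.
pose sd := Num.sqrt Sigma; have sd0 : 0 < sd by rewrite sqrtr_gt0.
have a01 : 0 <= a < 1.
  rewrite /a subr_ge0 gtrBl divr_gt0 ?mulr_gt0// andbT.
  by rewrite ler_pdivrMr ?mulr_gt0// mul1r; move: Sigma_lt; rewrite -/v; lra.
have /andP[a0 _] := a01.
have B0 : 0 <= B by rewrite mulr_ge0 ?norm_sum_ge0// ltW.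
have K0 : 0 < B + 2 * sd by rewrite ltr_wpDl// mulr_gt0.
(* The radius prescribed by the contraction argument for [K = B + 2 * sd]; the minorization has to
   hold on this ball. *)
pose r := 4 * (B + 2 * sd) / (1 - a).
have [rho [W [rho01 cv]]] := harris_convergence a01 K0
  (weight_mixture_minorant a B r sd0) (Rintegral_mixture_minorant_gt0 sd a B r).
have dp : drift_minorized _ _ _ _ (langevin_density s v Sigma y) :=
  drift_minorized_langevin s y v0 Sigma0 a0 r.
have dq N : drift_minorized _ _ _ _ (noisy_density s v Sigma y N) :=
  drift_minorized_noisy s y v0 Sigma0 a0 N r.
have [mp _ _] := dp.
have mq N : markov_density (noisy_density s v Sigma y N) by case: (dq N).
have [piS [ergS limS]] := ex_geometric_limit rho01 mp (cv _ dp).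
have /choice[piN /all_and2[ergN limN]] N :=
  ex_geometric_limit rho01 (mq N) (cv _ (dq N)).
(* Drift and minorization hold for every [N], so the threshold can be zero. *)
exists piS; split => //; exists 0%N, piN; split => [N _|]; first exact: ergN.
apply: tv_dist_cvg0 => e e0.
have e40 : 0 < e / 4 by rewrite divr_gt0.
(* The budget [e] is split into [e / 4] for each chain to approach its limit from [0] and [e / 2]
   for the distance between the two [n]-step laws. The uniform rate lets [n] be fixed before [N]. *)
have [n Wn] : exists n, W 0 * rho ^+ n <= e / 4.
  have /cvgrPdist_le/(_ _ e40)[n _ /(_ n (leqnn n))] :
      (fun n => W 0 * rho ^+ n) @ \oo --> 0.
    rewrite -[X in _ --> X](mulr0 (W 0)); apply: cvgM; first exact: cvg_cst.
    by have /andP[rho0 rho1] := rho01; apply: cvg_expr; rewrite ger0_norm.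
  by rewrite /= sub0r normrN => h; exists n; rewrite (le_trans _ h)// ler_norm.
(* Each step costs at most [2 * d]: one [d] from AM-GM and one from the variance term once
   [N > C / d]. Dividing by [n.+1] keeps [d] meaningful for [n = 0]. *)
pose d := e / 4 / n.+1%:R; have d0 : 0 < d by rewrite divr_gt0.
pose C := (1 + 4 / d) / Sigma * B ^+ 2.
have := nbhs_infty_gtr (C / d); apply: filterS2 (nbhs_infty_gt 0) => N N0 CN.
have pq g z : unit_valued g -> `|transition (langevin_density s v Sigma y) g z -
    transition (noisy_density s v Sigma y N) g z| <= 2 * d.
  move=> ug; apply: le_trans (transition_noisy_dist s y v0 Sigma0 z N0 d0 ug) _.
  rewrite -/B -/C mulr_natl mulr2n lerD2l ler_pdivrMr ?ltr0n//.
  by rewrite mulrC -ler_pdivrMr// ltW.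
apply: tv_dist_le => A mA.
have [l piSE Sl] := limS A mA; have [l' piNE Nl] := limN N A mA.
exists l, l'; split => //.
have h := iter_transition_dist_le n 0 mp (mq N) pq (unit_valued_indic mA).
have h1 := Sl 0 n; have h2 := Nl 0 n.
have nd : n%:R * (2 * d) <= e / 2.
  have -> : e / 2 = n.+1%:R * (2 * d).
    by rewrite mulrCA (mulrC _ d) /d divfK ?pnatr_eq0//; field.
  by rewrite ler_wpM2r ?mulr_ge0 ?ler_nat// ltW.
move: h h1 h2; set P := iter n _ _ _; set Q := iter n _ _ _ => h h1 h2.
rewrite (_ : l - l' = - (P - l) + (P - Q) + (Q - l')); last by ring.
rewrite (le_trans (ler_normD _ _))// (_ : e = e / 4 + e / 2 + e / 4); last by field.
rewrite lerD ?(le_trans h2)// (le_trans (ler_normD _ _))// normrN.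
by rewrite lerD ?(le_trans h1)// (le_trans h).
Qed.
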